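(* Let $c\geq 1$ be a real number and let $G$ be a finite graph with growth $f_G(r)\leq cr$ for every positive integer $r$. Then $G$ is isomorphic to a subgraph of $T\boxtimes K_{\lfloor 882c^3\rfloor}$ for some tree $T$.
   Context: The growth of a finite graph $G$ is the function $f_G\colon\mathbb{N}\to\mathbb{N}$ where $f_G(r)$ is the maximum of $|V(H)|$ over all subgraphs $H$ of $G$ of radius at most $r$. $K_t$ is the complete graph on $t$ vertices. The strong product $G\boxtimes H$ has vertex set $V(G)\times V(H)$, with distinct vertices $(v,w)$ and $(v',w')$ adjacent iff ($vv'\in E(G)$ and $w=w'$), or ($v=v'$ and $ww'\in E(H)$), or ($vv'\in E(G)$ and $ww'\in E(H)$). *)

(* Defs.v *)
From HB Require Import structures.
From mathcomp Require Import all_boot all_order all_algebra.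
From mathcomp Require Import reals.
Set Implicit Arguments. Unset Strict Implicit. Unset Printing Implicit Defensive.
Import Order.TTheory GRing.Theory Num.Theory.

Definition simple_graph (V : finType) (e : rel V) : Prop :=
  symmetric e /\ irreflexive e.

Definition is_subgraph (V : finType) (e : rel V) (H : {set V} * {set V * V}) : bool :=
  [forall x : V, forall y : V,
     ((x, y) \in H.2) ==> [&& x \in H.1, y \in H.1, e x y & (y, x) \in H.2]].

Fixpoint ball (V : finType) (E : {set V * V}) (n : nat) (x : V) : {set V} :=
  match n with
  | 0 => [set x]
  | n'.+1 => ball E n' x :|: [set y | [exists z in ball E n' x, (z, y) \in E]]
  end.

Definition radius_le (V : finType) (H : {set V} * {set V * V}) (r : nat) : bool :=
  [exists v in H.1, H.1 \subset ball H.2 r v].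

Definition growth (V : finType) (e : rel V) (r : nat) : nat :=
  \max_(H : {set V} * {set V * V} | is_subgraph e H && radius_le H r) #|H.1|.

Definition is_tree (T : finType) (eT : rel T) : Prop :=
  [/\ 0 < #|T|, simple_graph eT,
      (forall x y : T, connect eT x y) &
      ~ (exists (x : T) (p : seq T),
            [/\ 2 <= size p, uniq (x :: p), path eT x p & eT (last x p) x])].

Definition complete_rel (t : nat) : rel 'I_t := fun i j => i != j.

Definition strong_prod (A B : eqType) (eA : rel A) (eB : rel B) : rel (A * B) :=
  fun u w =>
    [|| eA u.1 w.1 && (u.2 == w.2), (u.1 == w.1) && eB u.2 w.2
      | eA u.1 w.1 && eB u.2 w.2].

(* Main.v *)
(** Every induced subgraph inherits the bound #|B(x, r)| <= c r.  Given a set S,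
let r be minimal such that some ball B(v, r) contains more than half of S.
A maximal packing of balls of radius r/4 centred in B(v, r) has at most 5c
members; the concentric balls of radius r/2 cover B(v, r), and each of them can
be enlarged to a ball of radius at most r whose boundary layer has at most 2c
vertices.  Deleting these layers leaves only parts containing at most half of S:
either a part lies in a ball of radius less than r, or it avoids B(v, r).  So all
induced subgraphs have separators of size k <= 10 c^2, balanced with respect to
any prescribed S.

As for graphs of bounded treewidth and degree d <= c, this gives a tree-partition
whose root bag contains a prescribed set S of size at most 18kd: if S is small,
take S as the root bag and recurse on the neighbourhood of S in the rest of the
graph; if S is large, split the graph along a separator balanced with respect to
S, recurse on both sides, and merge the two root bags.  The bags have size at
most 27kd <= 270 c^3. *)
Require Import Defs.
From HB Require Import structures.
From mathcomp Require Import all_boot all_order all_algebra.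
From mathcomp Require Import reals.
From mathcomp Require Import zify lra.
Import Order.TTheory GRing.Theory Num.Theory.
Local Open Scope ring_scope.
Set Implicit Arguments. Unset Strict Implicit. Unset Printing Implicit Defensive.

(** * Balls in a finite graph *)

Lemma ball_succP (V : finType) (E : {set V * V}) n (x y : V) :
  reflect (y \in ball E n x \/ exists2 z, z \in ball E n x & (z, y) \in E)
          (y \in ball E n.+1 x).
Proof.
rewrite /= !inE; apply: (iffP orP) => [[->|]|[->|[z zB zy]]]; [by left| |by left|].
  by case/exists_inP=> z zB zy; right; exists z.
by right; apply/exists_inP; exists z.
Qed.

Lemma ball_center (V : finType) (E : {set V * V}) n (x : V) : x \in ball E n x.
Proof. by elim: n => [|n IH]; [rewrite inE | apply/ball_succP; left]. Qed.

Lemma ball_mono (V : finType) (E : {set V * V}) m n (x : V) :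
  (m <= n)%N -> ball E m x \subset ball E n x.
Proof.
elim: n => [|n IH]; first by rewrite leqn0 => /eqP->.
rewrite leq_eqVlt => /predU1P[->//|/IH mn].
by apply: subset_trans mn _; apply: subsetUl.
Qed.

Lemma ball_edge (V : finType) (E : {set V * V}) (x y : V) :
  (x, y) \in E -> y \in ball E 1 x.
Proof. by move=> xy; apply/ball_succP; right; exists x; rewrite ?ball_center. Qed.

Lemma ball_trans (V : finType) (E : {set V * V}) m n (x y z : V) :
  y \in ball E m x -> z \in ball E n y -> z \in ball E (m + n) x.
Proof.
move=> xy; elim: n z => [|n IH] z; first by rewrite inE addn0 => /eqP->.
rewrite addnS => /ball_succP[/IH zB|[t /IH tB tz]]; apply/ball_succP; first by left.
by right; exists t.
Qed.

Lemma ball_sym (V : finType) (E : {set V * V}) n (x y : V) :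
  (forall a b, (a, b) \in E -> (b, a) \in E) ->
  y \in ball E n x -> x \in ball E n y.
Proof.
move=> symE; elim: n y => [|n IH] y; first by rewrite !inE eq_sym.
case/ball_succP=> [/IH yB|[z /IH zB /symE/ball_edge zy]].
  by apply/ball_succP; left.
by rewrite -add1n; apply: ball_trans zy zB.
Qed.

Lemma ball_stable (V : finType) (E : {set V * V}) m n (x : V) :
  ball E n.+1 x = ball E n x -> (n <= m)%N -> ball E m x = ball E n x.
Proof.
move=> eqn; elim: m => [|m IH]; first by rewrite leqn0 => /eqP->.
rewrite leq_eqVlt => /predU1P[->//|/IH eqm].
by rewrite -[RHS]eqn /= eqm.
Qed.

(** Until the ball stops growing, each unit of radius adds at least one vertex. *)
Lemma ball_large_or_stable (V : finType) (E : {set V * V}) q (x : V) :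
  (q < #|ball E q x|)%N \/ exists2 n, (n < q)%N & ball E n.+1 x = ball E n x.
Proof.
elim: q => [|q [IH|[n nq eqn]]]; first by left; rewrite cards1.
  have [eqq|neq] := eqVneq (ball E q.+1 x) (ball E q x); first by right; exists q.
  left; apply: leq_ltn_trans IH _; apply: proper_card.
  by rewrite properEneq eq_sym neq ball_mono.
by right; exists n => //; apply: ltnW.
Qed.

Lemma ball_stable_ex (V : finType) (E : {set V * V}) (x : V) :
  exists2 n, (n <= #|V|)%N & ball E n.+1 x = ball E n x.
Proof.
have [big|[n nV eqn]] := ball_large_or_stable E #|V| x; last by exists n; first exact: ltnW.
by have := leq_trans big (max_card _); rewrite ltnn.
Qed.

(** Averaging: the [b - a] layers between the two radii are disjoint and lie in the ball of radius
    [b], so the thinnest is at most their mean. *)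
Lemma thin_layer (V : finType) (E : {set V * V}) a b (x : V) : (a < b)%N ->
  exists2 m, (a <= m < b)%N &
    ((b - a) * #|ball E m.+1 x :\: ball E m x| <= #|ball E b x|)%N.
Proof.
move=> ab; pose layer m := #|ball E m.+1 x :\: ball E m x|.
pose P (i : 'I_b) := (a <= i)%N.
case: (arg_minnP (fun i : 'I_b => layer i) (leqnn a : P (Ordinal ab))) => m am minm.
exists m; first by rewrite ltn_ord andbT.
suff: forall j, (a <= j)%N -> (j <= b)%N -> ((j - a) * layer m <= #|ball E j x|)%N.
  by apply=> //; apply: ltnW.
elim=> [|j IH] aj jb; first by rewrite sub0n.
move: aj; rewrite leq_eqVlt => /predU1P[<-|aj]; first by rewrite subnn.
have:= minm (Ordinal jb) aj; have:= IH aj (ltnW jb); rewrite /layer /=.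
have := cardsID (ball E j x) (ball E j.+1 x).
rewrite (setIidPr (ball_mono E x (leqnSn j))) /= subSn // mulSn; lia.
Qed.

(** * Induced subgraphs, growth and packings of balls *)

Definition induced (V : finType) (e : rel V) (U : {set V}) : {set V * V} :=
  [set p | [&& p.1 \in U, p.2 \in U & e p.1 p.2]].

Lemma induced_sym (V : finType) (e : rel V) (U : {set V}) : symmetric e ->
  forall a b, (a, b) \in induced e U -> (b, a) \in induced e U.
Proof. by move=> symE a b; rewrite !inE /= symE; case/and3P=> -> -> ->. Qed.

Lemma ball_induced_sub (V : finType) (e : rel V) (U : {set V}) n x :
  x \in U -> ball (induced e U) n x \subset U.
Proof.
move=> xU; elim: n => [|n IH]; first by rewrite sub1set.
apply/subsetP=> y /ball_succP[/(subsetP IH)//|[z _]].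
by rewrite inE /= => /and3P[].
Qed.

(** The ball with the edges inside it is an admissible subgraph: walks of length at most [r] from
    the centre never leave it, so its radius is still at most [r]. *)
Lemma card_ball_growth (V : finType) (e : rel V) (U : {set V}) r x :
  symmetric e -> (#|ball (induced e U) r x| <= growth e r)%N.
Proof.
move=> symE; set B := ball _ r x; set E := induced e U.
pose F := [set p in E | (p.1 \in B) && (p.2 \in B)].
apply: (@leq_bigmax_cond _ _ (fun H : {set V} * {set V * V} => #|H.1|) (B, F)).
apply/andP; split.
  apply/forallP=> a; apply/forallP=> b; apply/implyP; rewrite !inE /=.
  by case/andP=> /and3P[-> -> ab] /andP[-> ->]; rewrite ab symE ab.
apply/exists_inP; exists x; first exact: ball_center.
have sub n : (n <= r)%N -> ball E n x \subset ball F n x.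
  elim: n => [|n IH] nr //; apply/subsetP=> y yn; apply/ball_succP.
  have yB : y \in B by apply: (subsetP (ball_mono E x nr)).
  case/ball_succP: yn => [/(subsetP (IH (ltnW nr)))|[z zn zy]]; [by left|right].
  exists z; first by apply: (subsetP (IH (ltnW nr))).
  by rewrite inE zy yB (subsetP (ball_mono E x (ltnW nr))).
exact: sub.
Qed.

(** [D] is a maximal set of centres with disjoint balls: maximality gives the cover by balls of
    doubled radius, disjointness the count. *)
Lemma ball_packing (V : finType) (E : {set V * V}) (B : {set V}) q k :
  (forall a b, (a, b) \in E -> (b, a) \in E) ->
  (forall x, x \in B -> (k <= #|ball E q x|)%N) ->
  exists D : {set V},
    [/\ D \subset B,
        forall y, y \in B -> exists2 x, x \in D & y \in ball E (q + q) x &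
        (#|D| * k <= #|\bigcup_(x in B) ball E q x|)%N].
Proof.
move=> symE big.
pose P (D : {set V}) := (D \subset B) && [forall x in D, forall y in D,
  (x != y) ==> [disjoint ball E q x & ball E q y]].
have [|D /maxsetP[/andP[DB /forall_inP disjD] maxD] _] := @maxset_exists _ P set0.
  by rewrite /P sub0set; apply/forall_inP=> x; rewrite inE.
exists D; split=> //.
  move=> y yB; have [yD|yD] := boolP (y \in D); first by exists y; rewrite ?ball_center.
  have [/exists_inP[x xD]|] :=
    boolP [exists x in D, ~~ [disjoint ball E q x & ball E q y]].
    rewrite -setI_eq0 => /set0Pn[z /setIP[zx zy]]; exists x => //.
    exact: ball_trans zx (ball_sym symE zy).
  rewrite negb_exists_in => /forall_inP dis; case/negP: yD.
  rewrite -(maxD (y |: D)) ?setU11 ?subsetUr // /P subUset sub1set yB DB /=.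
  apply/forall_inP=> a aD; apply/forall_inP=> b bD; apply/implyP=> ab.
  case/setU1P: aD => [ay|aD]; case/setU1P: bD => [b_y|bD]; subst.
  - by rewrite eqxx in ab.
  - by rewrite disjoint_sym; move: (dis b bD); rewrite negbK.
  - by move: (dis a aD); rewrite negbK.
  - by move/forall_inP: (disjD a aD) => /(_ b bD) /implyP; apply.
(* Empty sets off [D] make the family pairwise disjoint over all of [V], so that cardinalities add
   up. *)
pose F x := if x \in D then ball E q x else set0.
have disF x y : x != y -> [disjoint F x & F y].
  move=> xy; rewrite /F; case: ifP => xD; last by rewrite -setI_eq0 set0I.
  case: ifP => yD; last by rewrite -setI_eq0 setI0.
  by move/forall_inP: (disjD x xD) => /(_ y yD) /implyP; apply.
have subF : \bigcup_x F x \subset \bigcup_(x in B) ball E q x.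
  apply/bigcupsP=> x _; rewrite /F; case: ifP => xD; last exact: sub0set.
  by apply: (bigcup_max x) => //; apply: (subsetP DB).
apply: leq_trans (subset_leq_card subF).
have -> : #|\bigcup_x F x| = (\sum_x #|F x|)%N.
  rewrite -sum1_card (@partition_disjoint_bigcup _ _ _ _ _ F (fun=> 1%N) disF).
  by apply: eq_bigr => x _; rewrite sum1_card.
rewrite (bigID (mem D)) /= -sum_nat_const.
apply: leq_trans (leq_addr _ _); apply: leq_sum => x xD.
by rewrite /F xD big // (subsetP DB).
Qed.

(** * Balanced separators from linear growth *)

(** An edge-closed [C] stands in for the component of [x] in [U :\: X], which it contains; any union
    of components may serve as witness. *)
Definition small_part (V : finType) (e : rel V) (U S X : {set V}) (x : V) : Prop :=
  exists C : {set V},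
    [/\ x \in C, C \subset U :\: X,
        forall y z, y \in C -> z \in U :\: X -> e y z -> z \in C &
        (2 * #|C :&: S| <= #|S|)%N].

(** No edge of [U :\: X] leaves [C], so the complement of [C] there is edge-closed too; it misses
    [B], which holds more than half of [S]. *)
Lemma outer_part (V : finType) (e : rel V) (U S X B C : {set V}) (x : V) :
  symmetric e -> S \subset U -> B \subset C -> (#|S| < 2 * #|B :&: S|)%N ->
  (forall y z, y \in C -> z \in U :\: X -> y \notin X -> e y z -> z \in C) ->
  x \in U :\: X -> x \notin C -> small_part e U S X x.
Proof.
move=> symE SU BC Bbig closC xUX xC.
exists ((U :\: X) :\: C); split; first by rewrite inE xC.
- exact: subsetDl.
- move=> y z /setDP[yUX yC] zUX yz; rewrite inE zUX andbT.
  apply: contra yC => zC; apply: (closC z) => //; first by case/setDP: zUX.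
  by rewrite symE.
have : (#|((U :\: X) :\: C) :&: S| + #|B :&: S| <= #|S|)%N.
  rewrite -[X in (_ <= X)%N](cardsID B S) addnC setIC leq_add2l.
  apply: subset_leq_card; apply/subsetP=> y; rewrite !inE.
  by case/andP=> /and3P[yC _ _] ->; rewrite andbT; apply: contra yC; apply: (subsetP BC).
lia.
Qed.

Lemma balanced_separator (R : realType) (c : R) (V : finType) (e : rel V) (U S : {set V}) :
  1 <= c -> symmetric e ->
  (forall x r, (0 < r)%N -> #|ball (induced e U) r x|%:R <= c * r%:R) ->
  S \subset U ->
  exists X : {set V}, [/\ X \subset U, #|X|%:R <= 10%:R * c ^+ 2 &
    forall x, x \in U :\: X -> small_part e U S X x].
Proof.
move=> c1 symE grow SU; set E := induced e U.
have symI : forall a b, (a, b) \in E -> (b, a) \in E := induced_sym symE.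
have ballU n x : x \in U -> ball E n x \subset U := @ball_induced_sub _ e U n x.
have edgeE y z : y \in U -> z \in U -> e y z -> (y, z) \in E.
  by move=> yU zU yz; rewrite !inE /= yU zU.
pose P n := [exists v in U, (#|S| < 2 * #|ball E n v :&: S|)%N].
have [[r0 Pr0]|noP] : (exists n, P n) \/ forall n, ~~ P n.
  (* All balls are stable by radius [#|V|], so this one radius decides the alternative. *)
  have [PV|nPV] := boolP (P #|V|); first by left; exists #|V|.
  right=> n; apply: contra nPV => /exists_inP[v vU vbig].
  apply/exists_inP; exists v => //; apply: leq_trans vbig _.
  rewrite leq_mul2l /= subset_leq_card // setSI //.
  have [nV|/ltnW Vn] := leqP n #|V|; first exact: ball_mono.
  have [m mV eqm] := ball_stable_ex E v.
  by rewrite (ball_stable eqm mV) (ball_stable eqm (leq_trans mV Vn)).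
- have exP : exists n, P n by exists r0.
  case: (ex_minnP exP) => -[|r] {exP r0 Pr0}; last first.
  move: r.+1 (ltn0Sn r) => n n_gt0 /exists_inP[v vU vbig] minr.
  have small m x : (m < n)%N -> x \in U -> (2 * #|ball E m x :&: S| <= #|S|)%N.
    move=> mn xU; rewrite leqNgt; apply/negP=> big.
    have : P m by apply/exists_inP; exists x.
    by move/minr; rewrite leqNgt mn.
  (* Balls of radius [2 * q] will cover [B], and at least [n / 2] radii remain between [2 * q] and
     [n] for choosing a thin layer. *)
  pose q := (n %/ 4)%N; pose B := ball E n v.
  have q2n : (2 * (2 * q) <= n)%N by rewrite /q; lia.
  (* A smaller ball would be stable at some radius [m < n], hence contain [B] and more than half of
     [S], against the minimality of [n]. *)
  have bigball x : x \in B -> (q.+1 <= #|ball E q x|)%N.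
    move=> xB; have xU := subsetP (ballU n v vU) x xB.
    have [//|[m mq eqm]] := ball_large_or_stable E q x.
    have mn : (m < n)%N by lia.
    have := small m x mn xU; rewrite leqNgt; case/negP.
    apply: leq_trans vbig _; rewrite leq_mul2l /= subset_leq_card // setSI //.
    have mnn : (m <= n + n)%N by lia.
    rewrite -(ball_stable eqm mnn).
    by apply/subsetP=> y; apply: ball_trans (ball_sym symI xB).
  have [D [DB cover cardD]] := ball_packing symI bigball.
  have DU x : x \in D -> x \in U.
    by move=> xD; apply: (subsetP (ballU n v vU)); apply: (subsetP DB).
  (* The disjoint balls have at least [q + 1] vertices each and lie in a ball of radius
     [n + q <= 5 * (q + 1)]. *)
  have {}cardD : #|D|%:R <= 5%:R * c.
    have sub : \bigcup_(x in B) ball E q x \subset ball E (n + q) v.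
      by apply/bigcupsP=> x xB; apply/subsetP=> y; apply: (ball_trans xB).
    have cD := leq_trans cardD (subset_leq_card sub).
    have : (#|D| * q.+1)%:R <= c * (n + q)%:R :> R.
      by apply: le_trans (grow v (n + q)%N _); rewrite ?ler_nat // addn_gt0 n_gt0.
    have : (n + q)%:R <= (5 * q.+1)%:R :> R by rewrite ler_nat /q; lia.
    rewrite !natrM => le5 leD.
    rewrite -(ler_pM2r (_ : 0 < q.+1%:R)) ?ltr0n //.
    apply: le_trans leD _; rewrite -mulrA mulrCA ler_wpM2l //; lra.
  have layers x : exists m, [&& (2 * q <= m)%N, (m < n)%N &
      ((n - 2 * q) * #|ball E m.+1 x :\: ball E m x| <= #|ball E n x|)%N].
    have ltq : (2 * q < n)%N by lia.
    by have [m /andP[am mb] lm] := thin_layer E x ltq; exists m; apply/and3P.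
  pose d x := xchoose (layers x).
  pose L x := ball E (d x).+1 x :\: ball E (d x) x.
  have dP x : [/\ (2 * q <= d x)%N, (d x < n)%N & #|L x|%:R <= 2%:R * c].
    have /and3P[dq dn dl] := xchooseP (layers x); split=> //.
    have : ((n - 2 * q) * #|L x|)%:R <= c * n%:R :> R.
      by apply: le_trans (grow x n _); rewrite ?ler_nat.
    have : n%:R <= (2 * (n - 2 * q))%:R :> R by rewrite ler_nat; lia.
    have pos : 0 < (n - 2 * q)%:R :> R by rewrite ltr0n; lia.
    rewrite !natrM => le2 leL; rewrite -(ler_pM2l pos).
    by apply: le_trans leL _; rewrite mulrCA [leRHS]mulrC [X in _ <= X]mulrC; nra.
  pose X := \bigcup_(x in D) L x.
  have XU : X \subset U.
    apply/bigcupsP=> x xD; apply: subset_trans (subsetDl _ _) _.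
    exact/ballU/DU.
  exists X; split=> //.
    have cX : (#|X| <= \sum_(x in D) #|L x|)%N.
      rewrite /X; elim/big_rec2: _ => [|x m A _ IH]; first by rewrite cards0.
      by apply: leq_trans (leq_card_setU _ _) _; rewrite leq_add2l.
    apply: (@le_trans _ _ (\sum_(x in D) #|L x|)%:R); first by rewrite ler_nat.
    rewrite natr_sum; apply: (@le_trans _ _ (\sum_(x in D) 2%:R * c)).
      by apply: ler_sum => x _; have [] := dP x.
    rewrite sumr_const -mulr_natr; nra.
  (* An edge leaving the ball of radius [d x] ends in the layer [L x], hence in [X]. *)
  have inner x y z : x \in D -> y \in ball E (d x) x -> y \in U -> z \in U :\: X ->
      e y z -> z \in ball E (d x) x.
    move=> xD yx yU /setDP[zU zX] yz; apply: contraR zX => zx.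
    apply/bigcupP; exists x => //; rewrite inE zx /=.
    by apply/ball_succP; right; exists y => //; apply: edgeE.
  pose C := \bigcup_(x in D) ball E (d x).+1 x.
  move=> x xUX; have [/bigcupP[a aD xa]|xC] := boolP (x \in C).
    have /setDP[xU xX] := xUX.
    have {}xa : x \in ball E (d a) a.
      by apply: contraR xX => xda; apply/bigcupP; exists a; rewrite // inE xda.
    exists (ball E (d a) a :\: X); split.
    + by rewrite inE xX.
    + by apply: setSD; apply/ballU/DU.
    + move=> y z /setDP[ya _] zUX yz; have /setDP[_ zX] := zUX.
      rewrite inE zX; apply: (inner a y) => //.
      exact: (subsetP (ballU _ _ (DU a aD)) _ ya).
    have [_ dn _] := dP a; apply: leq_trans (small _ a dn (DU a aD)).
    by rewrite leq_mul2l /= subset_leq_card // setSI // subsetDl.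
  apply: (@outer_part _ _ _ _ _ B C) => //.
    apply/subsetP=> y /cover[a aD ya]; apply/bigcupP; exists a => //.
    have [dq _ _] := dP a; apply: (subsetP (ball_mono E a _)) ya; lia.
  move=> y z /bigcupP[a aD ya] zUX yX yz; apply/bigcupP; exists a => //.
  apply: (subsetP (ball_mono E a (leqnSn _))); apply: (inner a y) => //.
    by apply: contraR yX => nya; apply/bigcupP; exists a; rewrite // inE nya.
  exact: (subsetP (ballU _ _ (DU a aD)) _ ya).
  (* Minimal radius 0: the vertex [v] alone is more than half of [S], so deleting it suffices. *)
  case/exists_inP=> v vU vbig _; exists [set v]; split; first by rewrite sub1set.
  + by rewrite cards1; nra.
  move=> x xUv; apply: (@outer_part _ _ _ _ _ [set v] [set v]) => //.
  + by move=> y z ->.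
  + by case/setDP: xUv.
(* No ball holds more than half of [S]: nothing is deleted, and the stable ball around [x] is its
   component. *)
exists set0; split; first exact: sub0set.
  by rewrite cards0; nra.
move=> x; rewrite setD0 => xU.
have [m mV eqm] := ball_stable_ex E x.
exists (ball E m x); rewrite setD0; split; first exact: ball_center.
- exact: ballU.
- move=> y z yx zU yz; rewrite -eqm; apply/ball_succP; right; exists y => //.
  by apply: edgeE => //; apply: (subsetP (ballU _ _ xU)) yx.
rewrite leqNgt; apply/negP=> big; case/negP: (noP m).
by apply/exists_inP; exists x.
Qed.

Definition separation (V : finType) (e : rel V) (U A B X : {set V}) : Prop :=
  [/\ A \subset U :\: X, B = (U :\: X) :\: A &
      forall y z, y \in A -> z \in B -> ~~ e y z].

(** Among edge-closed sets with at most 2/3 of [S], take [A] with the largest share. If [B] had more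
    than 2/3, a part [C] meeting [B :&: S] would allow an improvement, to [A :|: C] or to [C]
    alone. *)
Lemma balanced_separation (V : finType) (e : rel V) (U S X : {set V}) :
  S \subset U -> (forall x, x \in U :\: X -> small_part e U S X x) ->
  exists A B : {set V},
    [/\ separation e U A B X, (3 * #|A :&: S| <= 2 * #|S|)%N &
        (3 * #|B :&: S| <= 2 * #|S|)%N].
Proof.
move=> SU parts.
pose P (A : {set V}) := [&& A \subset U :\: X,
  [forall y in A, forall z in (U :\: X) :\: A, ~~ e y z] &
  (3 * #|A :&: S| <= 2 * #|S|)%N].
have P0 : P set0.
  rewrite /P sub0set set0I cards0 muln0 /= andbT.
  by apply/forall_inP=> y; rewrite inE.
case: (arg_maxnP (fun A : {set V} => #|A :&: S|) P0) => A PA maxA.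
have /and3P[AUX /forall_inP closA balA] := PA.
exists A, ((U :\: X) :\: A); split=> //.
  by split=> // y z yA zB; move/forall_inP: (closA y yA) => /(_ z zB).
rewrite leqNgt; apply/negP=> bigB.
have /set0Pn[x /setIP[/setDP[xUX xA] xS]] : ((U :\: X) :\: A) :&: S != set0.
  by rewrite -card_gt0; lia.
have [C [xC CUX closC halfC]] := parts x xUX.
have closP (D : {set V}) : D \subset U :\: X ->
    (forall y z, y \in D -> z \in U :\: X -> e y z -> z \in D) ->
    (3 * #|D :&: S| <= 2 * #|S|)%N -> P D.
  move=> DUX closD balD; rewrite /P DUX balD andbT /=.
  apply/forall_inP=> y yD; apply/forall_inP=> z /setDP[zUX zD].
  by apply: contra zD => yz; apply: (closD y).
have AB : (#|A :&: S| + #|((U :\: X) :\: A) :&: S| <= #|S|)%N.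
  rewrite -[leqRHS](cardsID A S) setIC leq_add2l subset_leq_card //.
  by apply/subsetP=> y; rewrite !inE => /andP[/and3P[-> _ _] ->].
have ltC : (#|A :&: S| < #|(A :|: C) :&: S|)%N.
  apply: proper_card; apply/properP; split; first by rewrite setSI // subsetUl.
  by exists x; rewrite !inE ?xC ?xS ?orbT ?(negbTE xA).
have UC : (#|(A :|: C) :&: S| <= #|A :&: S| + #|C :&: S|)%N.
  by rewrite setIUl; apply: leq_card_setU.
have [bal|unbal] := leqP (3 * #|(A :|: C) :&: S|) (2 * #|S|).
  suff /maxA : P (A :|: C) by rewrite /= leqNgt ltC.
  apply: closP => //; first by rewrite subUset AUX.
  move=> y z /setUP[yA|yC] zUX yz; rewrite inE; last by rewrite (closC y z) ?orbT.
  have [//|zA] := boolP (z \in A).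
  have /forall_inP/(_ z) := closA y yA.
  by rewrite yz inE zA zUX => /(_ isT).
(* Here [A] has less than 1/3 of [S] and [A :|: C] more than 2/3, so [C] has more than 1/3 and beats
   [A]. *)
have /maxA /= : P C by apply: closP => //; lia.
lia.
Qed.

(** * Tree-partitions over the tree of words *)

(* Tree nodes are words over nat, read from the root: the root is the empty
   word and the children of s are the words rcons s a. *)
Definition node_adj (s t : seq nat) : bool :=
  (s == rcons t (last 0%N s)) || (t == rcons s (last 0%N t)).

Lemma node_adjP (s t : seq nat) :
  reflect (exists a, s = rcons t a \/ t = rcons s a) (node_adj s t).
Proof.
apply: (iffP orP) => [[/eqP|/eqP] eqs|[a [->|->]]].
- by exists (last 0%N s); left.
- by exists (last 0%N t); right.
- by left; rewrite last_rcons.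
- by right; rewrite last_rcons.
Qed.

Lemma node_adj_sym : symmetric node_adj.
Proof. by move=> s t; rewrite /node_adj orbC. Qed.

(** The bag of a node is the fibre of [f] over it. All partitions share the infinite tree of words;
    a finite tree is cut out only at the end. *)
Definition tree_partition (V : finType) (e : rel V) (U : {set V})
    (f : V -> seq nat) (w : nat) : Prop :=
  (forall x y, x \in U -> y \in U -> e x y -> f x = f y \/ node_adj (f x) (f y)) /\
  (forall t, (#|[set x in U | f x == t]| <= w)%N).

(** The parity of the first letter records the side [b], so two tagged trees meet only in the
    root. *)
Definition tag_branch (b : bool) (s : seq nat) : seq nat :=
  if s is a :: s' then (b + a.*2)%N :: s' else [::].

Lemma tag_branch_adj b s t : node_adj s t -> node_adj (tag_branch b s) (tag_branch b t).
Proof.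
wlog [a ->] : s t / exists a, s = rcons t a => [wl /node_adjP[a [->|->]]|_].
- by apply: wl; [exists a | apply/node_adjP; exists a; left].
- by rewrite node_adj_sym; apply: wl; [exists a | apply/node_adjP; exists a; left].
by case: t => [|d t] /=; apply/node_adjP; [exists (b + a.*2)%N | exists a]; left.
Qed.

Lemma tag_branch_nil b s : (tag_branch b s == [::]) = (s == [::]).
Proof. by case: s. Qed.

Lemma tag_branch_cons b s a t :
  (tag_branch b s == a :: t) = (odd a == b) && (s == a./2 :: t).
Proof.
case: s => [|d s] /=; first by rewrite andbF.
rewrite !eqseq_cons andbA; congr (_ && _).
apply/eqP/andP=> [<-|[/eqP<- /eqP->]]; last exact: odd_double_half.
by rewrite oddD odd_double addbF half_bit_double oddb !eqxx.
Qed.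

(** Both trees are glued at the root, where [X] lies on either side. Every other bag comes from one
    side only, so just the root bags add up. *)
Lemma tree_partition_merge (V : finType) (e : rel V) (U A B X : {set V})
    (f1 f2 : V -> seq nat) w :
  symmetric e -> X \subset U -> separation e U A B X ->
  tree_partition e (A :|: X) f1 w -> tree_partition e (B :|: X) f2 w ->
  (forall x, x \in X -> f1 x = [::] /\ f2 x = [::]) ->
  (#|[set x in A :|: X | f1 x == [::]]| +
     #|[set x in B :|: X | f2 x == [::]]| <= w)%N ->
  exists f, [/\ tree_partition e U f w,
    (#|[set x in U | f x == [::]]| <= #|[set x in A :|: X | f1 x == [::]]| +
       #|[set x in B :|: X | f2 x == [::]]|)%N,
    {in A :|: X, forall x, f x = tag_branch false (f1 x)} &
    {in B :|: X, forall x, f x = tag_branch true (f2 x)}].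
Proof.
move=> symE XU [AUX eqB noAB] [adj1 card1] [adj2 card2] rootX cardr.
pose f x := if x \in A then tag_branch false (f1 x) else tag_branch true (f2 x).
have fA : {in A :|: X, forall x, f x = tag_branch false (f1 x)}.
  move=> x; rewrite /f inE; case: ifP => //= _ xX.
  by have [-> ->] := rootX x xX.
have fB : {in B :|: X, forall x, f x = tag_branch true (f2 x)}.
  move=> x; rewrite /f inE; case: ifP => //= xA.
  case/orP=> [|xX]; first by rewrite eqB inE xA.
  by have [-> ->] := rootX x xX.
have split_U x : x \in U -> (x \in A :|: X) || (x \in B :|: X).
  by move=> xU; rewrite eqB !inE xU; case: (x \in X); case: (x \in A).
have cross x y : x \in U -> y \in U -> e x y ->
    (x \in A :|: X) && (y \in A :|: X) || (x \in B :|: X) && (y \in B :|: X).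
  move=> xU yU xy; have := noAB x y; have := noAB y x.
  rewrite symE xy eqB !inE xU yU.
  case: (x \in A); case: (y \in A); case: (x \in X); case: (y \in X) => //= n1 n2.
  - by have := n2 isT isT.
  - by have := n1 isT isT.
have root_f : (#|[set x in U | f x == [::]]| <= #|[set x in A :|: X | f1 x == [::]]| +
    #|[set x in B :|: X | f2 x == [::]]|)%N.
  apply: leq_trans (leq_card_setU _ _).
  apply: subset_leq_card; apply/subsetP=> x; rewrite 2!inE => /andP[xU].
  case/orP: (split_U x xU) => xA; [rewrite fA|rewrite fB] => //;
    by rewrite tag_branch_nil => /eqP fx; rewrite inE !in_set fx eqxx -!in_setU xA ?orbT.
exists f; split=> //; split.
  move=> x y xU yU xy; case/orP: (cross x y xU yU xy) => /andP[xA yA].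
    rewrite (fA x xA) (fA y yA); case: (adj1 x y xA yA xy) => [->|adj]; first by left.
    by right; apply: tag_branch_adj.
  rewrite (fB x xA) (fB y yA); case: (adj2 x y xA yA xy) => [->|adj]; first by left.
  by right; apply: tag_branch_adj.
case=> [|a t].
  exact: leq_trans cardr.
pose g := if odd a then [set x in B :|: X | f2 x == a./2 :: t]
          else [set x in A :|: X | f1 x == a./2 :: t].
have gw : (#|g| <= w)%N by rewrite /g; case: ifP.
apply: leq_trans gw; apply: subset_leq_card; apply/subsetP=> x.
rewrite in_set => /andP[xU]; case/orP: (split_U x xU) => xA.
  by rewrite fA // tag_branch_cons => /andP[/eqP oa fx]; rewrite /g oa in_set xA.
by rewrite fB // tag_branch_cons => /andP[/eqP oa fx]; rewrite /g oa in_set xA.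
Qed.

(** [S] becomes a new root bag above the old root, whose bag holds all neighbours of [S]. *)
Lemma tree_partition_push (V : finType) (e : rel V) (U S : {set V})
    (f : V -> seq nat) w :
  symmetric e -> S \subset U -> tree_partition e (U :\: S) f w -> (#|S| <= w)%N ->
  (forall x y, x \in S -> y \in U :\: S -> e x y -> f y = [::]) ->
  tree_partition e U (fun x => if x \in S then [::] else 0%N :: f x) w.
Proof.
move=> symE SU [adj card] Sw rootN; split.
  have edgeS x y : x \in S -> y \notin S -> y \in U -> e x y -> node_adj [::] (0%N :: f y).
    by move=> xS yS yU xy; rewrite (rootN x y) // inE yS.
  move=> x y xU yU xy; case: ifP => xS; case: ifP => yS; first by left.
  - by right; apply: edgeS xy; rewrite ?yS.
  - by right; rewrite node_adj_sym; apply: (edgeS y x); rewrite ?xS // symE.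
  have xUS : x \in U :\: S by rewrite inE xS.
  have yUS : y \in U :\: S by rewrite inE yS.
  have [->|/node_adjP[a fa]] := adj x y xUS yUS xy; first by left.
  by right; apply/node_adjP; exists a; case: fa => ->; [left|right].
case=> [|a t].
  apply: leq_trans Sw; apply: subset_leq_card; apply/subsetP=> x.
  by rewrite inE => /andP[_]; case: ifP.
apply: leq_trans (card t); apply: subset_leq_card; apply/subsetP=> x.
rewrite !inE => /andP[xU]; case: ifP => // xS.
by rewrite eqseq_cons xU => /andP[].
Qed.

(* The bag of the root is allowed to grow only to 3/2 #|S|: the extra term
   [6 * k] is what keeps this bound stable when two root bags are merged
   along a separator of size [k]. *)
Lemma tree_partition_of_separators (V : finType) (e : rel V) (k d : nat) :
  symmetric e -> (0 < k)%N -> (0 < d)%N ->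
  (forall x, (#|[set y | e x y]| <= d)%N) ->
  (forall U S : {set V}, S \subset U ->
    exists X : {set V}, [/\ X \subset U, (#|X| <= k)%N &
      forall x, x \in U :\: X -> small_part e U S X x]) ->
  forall U S : {set V}, S \subset U -> (#|S| <= 18 * k * d)%N ->
  exists f, [/\ tree_partition e U f (27 * k * d), {in S, forall x, f x = [::]} &
    (6 * k <= #|S|)%N -> (2 * #|[set x in U | f x == [::]]| + 6 * k <= 3 * #|S|)%N].
Proof.
move=> symE k0 d0 deg sep U S.
have [n] := ubnP #|U|; elim: n U S => // n IH U S Un SU Sd.
have kd : (k <= k * d)%N by rewrite leq_pmulr.
have [Ssmall|Sbig] := leqP #|S| (18 * k).
  (* [S'] is the root bag: [S] itself, or a single vertex when [S] is empty, so that [U :\: S'] is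
     smaller than [U]. *)
  have push (S' : {set V}) : S' != set0 -> S \subset S' -> S' \subset U ->
      (#|S'| <= 18 * k)%N -> (6 * k <= #|S| -> S' = S)%N ->
      exists f, [/\ tree_partition e U f (27 * k * d), {in S, forall x, f x = [::]} &
    (6 * k <= #|S|)%N -> (2 * #|[set x in U | f x == [::]]| + 6 * k <= 3 * #|S|)%N].
    move=> S'0 SS' S'U S'k eqS.
    pose N := (\bigcup_(x in S') [set y | e x y]) :&: (U :\: S').
    have Nd : (#|N| <= 18 * k * d)%N.
      apply: leq_trans (subset_leq_card (subsetIl _ _)) _.
      apply: (@leq_trans (#|S'| * d)); last by rewrite leq_mul2r S'k orbT.
      rewrite -sum_nat_const; elim/big_ind2: _ => [|A m B p Am Bp|x _]; first by rewrite cards0.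
        by apply: leq_trans (leq_card_setU _ _) _; apply: leq_add.
      exact: deg.
    have ltU : (#|U :\: S'| < n)%N.
      have := cardsID S' U; rewrite (setIidPr S'U).
      move: S'0; rewrite -card_gt0; lia.
    have [f [fT fN _]] := IH (U :\: S') N ltU (subsetIr _ _) Nd.
    exists (fun x => if x \in S' then [::] else 0%N :: f x); split.
    - apply: tree_partition_push => //; first by lia.
      move=> x y xS yU xy; apply: fN; rewrite inE yU andbT.
      by apply/bigcupP; exists x; rewrite // inE.
    - by move=> x xS; rewrite (subsetP SS').
    move=> Sk.
    have -> : [set x in U | (if x \in S' then [::] else 0%N :: f x) == [::]] = S'.
      apply/setP=> x; rewrite inE; have [xS|xS] := boolP (x \in S').
        by rewrite (subsetP S'U).
      by rewrite andbF.
    by rewrite (eqS Sk); lia.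
  have [S0|S0] := eqVneq S set0; last by apply: (push S).
  have [U0|/set0Pn[x xU]] := eqVneq U set0; last first.
    apply: (push [set x]); rewrite ?S0 ?sub0set ?sub1set ?cards0 ?cards1 //; [|lia..].
    by apply/set0Pn; exists x; rewrite inE.
  exists (fun=> [::]); split=> [|//|]; last by rewrite S0 cards0; lia.
  split=> [x y|t]; first by rewrite U0 inE.
  by rewrite (_ : [set x in U | _] = set0) ?cards0 //; apply/setP=> x; rewrite U0 !inE.
have [X [XU Xk parts]] := sep U S SU.
have [A [B [sepAB balA balB]]] := balanced_separation SU parts.
have [AUX eqB noAB] := sepAB.
have AB : (#|A :&: S| + #|B :&: S| <= #|S|)%N.
  rewrite -[leqRHS](cardsID A S) setIC leq_add2l subset_leq_card // eqB.
  by apply/subsetP=> y; rewrite !inE => /andP[/and3P[-> _ _] ->].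
have SABX : (#|S| <= #|A :&: S| + #|B :&: S| + #|X|)%N.
  rewrite -addnA; apply: leq_trans (leq_add (leqnn _) (leq_card_setU _ _)).
  apply: leq_trans (leq_card_setU _ _); apply: subset_leq_card.
  apply/subsetP=> x xS; rewrite eqB !inE xS (subsetP SU) // !andbT.
  by case: (x \in A); case: (x \in X).
(* The other side has at most 2/3 of [S], so [C :&: S] and [X] together have at least
   [#|S| / 3 > 6 * k] vertices; this is the use of the threshold [18 * k]. *)
have side (C : {set V}) : C \subset U :\: X -> (3 * #|C :&: S| <= 2 * #|S|)%N ->
    (6 * k <= #|C :&: S| + #|X|)%N ->
  exists f, [/\ tree_partition e (C :|: X) f (27 * k * d),
    {in (C :&: S) :|: X, forall x, f x = [::]} &
    (2 * #|[set x in C :|: X | f x == [::]]| + 6 * k <= 3 * (#|C :&: S| + #|X|))%N].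
  move=> CUX balC bigC.
  have cardCX : #|(C :&: S) :|: X| = (#|C :&: S| + #|X|)%N.
    apply/eqP; rewrite (leq_card_setU _ _).2 -setI_eq0; apply/eqP/setP=> x.
    rewrite !inE; apply/negP=> /andP[/andP[/(subsetP CUX)]].
    by rewrite inE => /andP[/negP].
  have CXU : C :|: X \subset U by rewrite subUset XU (subset_trans CUX) // subsetDl.
  have ltU : (#|C :|: X| < n)%N.
    rewrite -ltnS; apply: leq_trans _ Un; rewrite ltnS; apply: proper_card.
    (* Otherwise [S] would have at most [2/3 * #|S| + k] elements, too few as [#|S| > 18 * k]. *)
    rewrite properEneq CXU andbT; apply/eqP=> eqU.
    have : (#|S| <= #|C :&: S| + #|X|)%N.
      apply: leq_trans (leq_card_setU _ _); apply: subset_leq_card.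
      apply/subsetP=> x xS; have := subsetP SU x xS.
      by rewrite -eqU !inE xS andbT.
    lia.
  have [|| f [fT fN]] := IH (C :|: X) ((C :&: S) :|: X) ltU; first exact/setSU/subsetIl.
    by rewrite cardCX; lia.
  by rewrite cardCX => /(_ bigC) fr; exists f.
have [||| f1 [T1 N1 r1]] := side A => //; first by lia.
have [||| f2 [T2 N2 r2]] := side B => //; [by rewrite eqB subsetDl | by lia |].
have rootX x : x \in X -> f1 x = [::] /\ f2 x = [::].
  by move=> xX; rewrite N1 ?N2 // inE xX orbT.
(* Adding the two root bounds counts [X] twice, at cost [3 * k], while halving the doubled term
   [12 * k] to [6 * k] saves as much. The merged root has at most [3/2 * 18 * k * d = 27 * k * d]
   vertices. *)
have [|f [fT fr fA fB]] := tree_partition_merge symE XU sepAB T1 T2 rootX; first by lia.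
exists f; split=> // [x xS|_]; last by lia.
have : x \in (A :&: S :|: X) :|: (B :&: S :|: X).
  rewrite eqB !inE xS (subsetP SU) // !andbT.
  by case: (x \in A); case: (x \in X).
case/setUP=> [xA|xB].
  by rewrite fA ?N1 //; apply: subsetP xA; apply/setSU/subsetIl.
by rewrite fB ?N2 //; apply: subsetP xB; apply/setSU/subsetIl.
Qed.

(** * From a tree-partition to a strong product *)

Lemma node_tree (nodes : seq (seq nat)) :
  [::] \in nodes -> (forall s a, rcons s a \in nodes -> s \in nodes) ->
  is_tree (fun s t : seq_sub nodes => node_adj (val s) (val t)).
Proof.
move=> root closed; set adj : rel (seq_sub nodes) := fun s t => _.
have adj_sym : symmetric adj by move=> s t; apply: node_adj_sym.
split.
- by apply/card_gt0P; exists (SeqSub root).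
- split=> // s; apply/negP=> /node_adjP[a] eqs.
  by case: eqs => /(congr1 size); rewrite size_rcons => /n_Sn.
- have toroot n : forall s : seq_sub nodes, size (val s) = n ->
      connect adj s (SeqSub root).
    elim: n => [|n IH] s sz; first by rewrite (_ : s = SeqSub root) //; apply/val_inj/size0nil.
    have [t [a eqs]] : exists t a, val s = rcons t a.
      by case/lastP: (val s) sz => // t a _; exists t, a.
    have tn : t \in nodes by apply: (closed t a); rewrite -eqs; apply: ssvalP.
    apply: (connect_trans (y := SeqSub tn)).
      by apply: connect1; apply/node_adjP; exists a; left.
    by apply: IH; move: sz; rewrite eqs size_rcons => -[].
  move=> s t; apply: connect_trans (toroot _ s erefl) _.
  by rewrite (sym_connect_sym adj_sym); apply: toroot.
(* A deepest node of a cycle has two distinct neighbours on it, but both of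
   them are its parent. *)
case=> x [p [p2 up pth lst]].
have cyc : cycle adj (x :: p) by rewrite /= rcons_path pth.
have [y yp deep] : exists2 y, y \in x :: p &
    forall z, z \in x :: p -> (size (val z) <= size (val y))%N.
  case: (@arg_maxnP _ x (mem (x :: p)) (fun y : seq_sub nodes => size (val y))).
    exact: mem_head.
  by move=> y yp deep; exists y.
have [i q eqq] := rot_to yp.
have szq : (2 <= size q)%N by rewrite -ltnS -[(size q).+1]/(size (y :: q)) -eqq size_rot ltnS.
have uq : uniq (y :: q) by rewrite -eqq rot_uniq.
have cycq : cycle adj (y :: q) by rewrite -eqq rot_cycle.
have deepq z : z \in y :: q -> (size (val z) <= size (val y))%N.
  by rewrite -eqq mem_rot; apply: deep.
have parent z : z \in y :: q -> adj y z -> exists a, val y = rcons (val z) a.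
  move=> zq /node_adjP[a [->|eqz]]; first by exists a.
  by have := deepq z zq; rewrite eqz size_rcons ltnn.
(* The cycle now starts at its deepest node [y]; its neighbours on the cycle are the first and last
   entries [z] and [t] of the rest. *)
case: q => [|z q] // in szq uq cycq deepq parent eqq *.
case/lastP: q => [|q t] // in szq uq cycq deepq parent eqq *.
have yz : adj y z by case/andP: cycq.
have yt : adj y t.
  by rewrite adj_sym; move: cycq; rewrite /= rcons_path last_rcons => /and3P[].
have [|a ya] := parent z _ yz; first by rewrite !inE eqxx orbT.
have [|b yb] := parent t _ yt; first by rewrite !(inE, mem_rcons) eqxx !orbT.
have zt : z = t.
  by apply: val_inj; move: yb; rewrite ya => /rcons_inj[].
by move: uq; rewrite /= zt !(inE, mem_rcons) eqxx /= andbF.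
Qed.

Lemma fiber_index (V : finType) (T : eqType) (g : V -> T) (w : nat) :
  (0 < w)%N -> (forall t, (#|[set x | g x == t]| <= w)%N) ->
  exists h : V -> 'I_w, forall x y, g x = g y -> h x = h y -> x = y.
Proof.
(* The label of [x] is its position in an enumeration of its fibre. *)
case: w => // w _ card; pose F x := enum [set y | g y == g x].
have inF x : x \in F x by rewrite mem_enum inE.
have ltF x : (index x (F x) < w.+1)%N.
  by apply: leq_trans (card (g x)); rewrite cardE index_mem.
exists (fun x => Ordinal (ltF x)) => x y gxy [].
rewrite /F gxy -/(F y) => eqi.
have xF : x \in F y by rewrite /F -gxy.
by rewrite -(nth_index x xF) eqi nth_index.
Qed.

Lemma tree_partition_embedding (V : finType) (e : rel V) (f : V -> seq nat) (w : nat) :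
  irreflexive e -> (0 < w)%N -> tree_partition e setT f w ->
  exists (T : finType) (eT : rel T), is_tree eT /\
    exists F : V -> T * 'I_w, injective F /\
      (forall x y : V, e x y -> strong_prod eT (@complete_rel w) (F x) (F y)).
Proof.
move=> irrE w0 [adj card].
(* The finite tree consists of all prefixes of used words; the explicit root keeps it nonempty when
   [V] is empty. *)
pose nodes := [::] :: [seq take i (f x) | x <- enum V, i <- iota 0 (size (f x)).+1].
have nodeP s : reflect (s = [::] \/ exists x i, s = take i (f x)) (s \in nodes).
  rewrite inE; apply: (iffP orP) => [[/eqP|/allpairsPdep[x [i [_ _ ->]]]]|[->|[x [i ->]]]].
  - by left.
  - by right; exists x, i.
  - by left.
  have [ix|xi] := leqP i (size (f x)).
    by right; apply/allpairsPdep; exists x, i; rewrite mem_enum mem_iota.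
  right; apply/allpairsPdep; exists x, (size (f x)).
  by rewrite mem_enum mem_iota ltnS leqnn take_size take_oversize // ltnW.
have root : [::] \in nodes by apply/nodeP; left.
have closed s a : rcons s a \in nodes -> s \in nodes.
  case/nodeP=> [|[x [i eqs]]]; first by case: s.
  apply/nodeP; right; exists x, (minn (size s) i).
  by rewrite take_min -eqs -cats1 take_size_cat.
have fnode x : f x \in nodes.
  by apply/nodeP; right; exists x, (size (f x)); rewrite take_size.
exists (seq_sub nodes), (fun s t => node_adj (val s) (val t)); split; first exact: node_tree.
have [t|h hinj] := @fiber_index V _ f w w0.
  by apply: leq_trans (card t); apply: subset_leq_card; apply/subsetP=> x; rewrite !inE.
exists (fun x => (SeqSub (fnode x), h x)); split.
  by move=> x y [fxy hxy]; apply: hinj.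
move=> x y xy; rewrite /strong_prod /complete_rel /=.
case: (adj x y (in_setT _) (in_setT _) xy) => [fxy|nadj]; last first.
  by rewrite nadj /=; case: eqP; rewrite ?orbT.
have -> : SeqSub (fnode x) == SeqSub (fnode y) by apply/eqP/val_inj.
suff -> : h x != h y by rewrite orbT.
by apply/eqP=> hxy; move: xy; rewrite (hinj x y fxy hxy) irrE.
Qed.

Theorem theorem13 (R : realType) (c : R) (hc : 1 <= c)
  (V : finType) (e : rel V) (hG : simple_graph e)
  (hgrowth : forall r : nat, (0 < r)%N -> ((growth e r)%:R <= c * r%:R)) :
  exists (T : finType) (eT : rel T),
    is_tree eT /\
    exists f : V -> T * 'I_(Num.truncn (882%:R * c ^+ 3)),
      injective f /\
      (forall x y : V, e x y -> strong_prod eT (@complete_rel _) (f x) (f y)).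
Proof.
have [symE irrE] := hG.
have c0 : 0 <= c by lra.
have ball_growth U x r : (0 < r)%N -> #|ball (induced e U) r x|%:R <= c * r%:R.
  by move=> r0; apply: le_trans (hgrowth r r0); rewrite ler_nat card_ball_growth.
set k := Num.truncn (10%:R * c ^+ 2); set d := Num.truncn c.
have k_le : k%:R <= 10%:R * c ^+ 2 by rewrite truncn_le; nra.
have d_le : d%:R <= c by rewrite truncn_le.
have c2 : 1 <= c ^+ 2 by rewrite exprn_ege1.
have k0 : (0 < k)%N by rewrite truncn_gt0; lra.
have d0 : (0 < d)%N by rewrite truncn_gt0.
(* The neighbours of [x] lie in its unit ball, which has at most [c] vertices. *)
have deg x : (#|[set y | e x y]| <= d)%N.
  rewrite truncn_ge_nat //.
  have := ball_growth setT x 1%N isT; rewrite mulr1; apply: le_trans.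
  rewrite ler_nat subset_leq_card //; apply/subsetP=> y; rewrite inE => xy.
  by apply: ball_edge; rewrite !inE.
have sep (U S : {set V}) : S \subset U ->
    exists X : {set V}, [/\ X \subset U, (#|X| <= k)%N &
      forall x, x \in U :\: X -> small_part e U S X x].
  move=> SU; have [X [XU Xc parts]] := balanced_separator hc symE (ball_growth U) SU.
  by exists X; split=> //; rewrite truncn_ge_nat //; nra.
have [|f [[adj card] _ _]] :=
  tree_partition_of_separators symE k0 d0 deg sep (sub0set [set: V]).
  by rewrite cards0.
(* Since [k <= 10 c^2] and [d <= c], the width is at most [270 c^3]. *)
have wide : (27 * k * d <= Num.truncn (882%:R * c ^+ 3))%N.
  have c3 : 0 <= c ^+ 3 by rewrite exprn_ge0.
  rewrite truncn_ge_nat ?mulr_ge0 // !natrM.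
  have : k%:R * d%:R <= 10%:R * c ^+ 2 * c by rewrite ler_pM.
  rewrite exprS mulrC in c3 *; nra.
apply: (@tree_partition_embedding _ _ f _ irrE).
  by apply: leq_trans wide; rewrite !muln_gt0 k0 d0.
by split=> // t; apply: leq_trans (card t) wide.
Qed.
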